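(* Suppose that the densities $g_S$ have finite second moments and satisfy, for a constant $c_1$ (not depending on $n$) and all $S'\subset S\subset\{1,\dots,n\}$, $$\log g_S(\theta)-\log g_S(\theta')\le c_1|S|+\tfrac1{64}\|\theta-\theta'\|^2\qquad\forall\,\theta,\theta'\in\mathbb{R}^S,$$ $$\bigl|\log g_S(\theta)-\log g_{S'}(\pi_{S'}\theta)\bigr|\le c_1|S|+\tfrac1{64}\|\pi_{S\setminus S'}\theta\|^2\qquad\forall\,\theta\in\mathbb{R}^S .$$ Suppose that for some $a\ge1$ and $b\ge e^{7+2c_1}$ and a constant $K$ not depending on $n$, $\pi_n(p)\le K e^{-ap\log(bn/p)}$ for every $p\in\{0,1,\dots,n\}$ (the exponent being $0$ for $p=0$). Then there is a constant $K'$, not depending on $n,p_n,r_n,r$, such that for any integer $1\le p_n\le n$, any $r_n>0$ satisfying $$r_n^2\ge\{p_n\log(n/p_n)\}\vee\log\frac1{\pi_n(p_n)},$$ and any $r\ge1$, $$\sup_{\theta_0\in\ell_0[p_n]}P_{n,\theta_0}\,\Pi_n\bigl(\theta:\|\theta-\theta_0\|>45r_n+10r\mid X\bigr)\le K'e^{-r^2/10}.$$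
   Context: For $\theta\in\mathbb{R}^n$, $P_{n,\theta}$ denotes the $N_n(\theta,I)$ distribution of $X=(X_1,\dots,X_n)$, with Lebesgue density $p_{n,\theta}$, and $P_{n,\theta}T$ denotes the expectation of $T=T(X)$ under it. The support of $\theta$ is $S_\theta=\{i:\theta_i\ne0\}$; $\ell_0[p]=\{\theta\in\mathbb{R}^n:|S_\theta|\le p\}$; $\|\cdot\|$ is the Euclidean norm; $a\vee b=\max(a,b)$; $\pi_{S'}\theta=(\theta_i:i\in S')$ is coordinate projection. Prior $\Pi_n$ on $\mathbb{R}^n$: (P1) a dimension $p$ is drawn from a probability measure $\pi_n$ on $\{0,1,\dots,n\}$ with $\pi_n(p)>0$ for every $p$; (P2) given $p$, a subset $S\subset\{1,\dots,n\}$ with $|S|=p$ is drawn uniformly from the $\binom np$ subsets of size $p$; (P3) given $(p,S)$, the vector $\theta_S=(\theta_i:i\in S)$ is drawn from a probability density $g_S$ on $\mathbb{R}^S$ (if $p\ge1$), and the coordinates $\theta_i$, $i\notin S$, are set equal to $0$. The density $g_S$ depends on $S$ only through $|S|$ (identifying $\mathbb{R}^S$ with $\mathbb{R}^{|S|}$); by convention $g_\emptyset=1$. Posterior: $\Pi_n(B\mid X)=\int_B p_{n,\theta}(X)\,d\Pi_n(\theta)\big/\int p_{n,\theta}(X)\,d\Pi_n(\theta)$ for Borel $B\subset\mathbb{R}^n$. *)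

(* Defs.v *)
From HB Require Import structures.
From mathcomp Require Import all_boot all_order all_algebra.
From mathcomp Require Import all_classical all_reals all_analysis.
From mathcomp Require Import measurable_realfun.

Set Implicit Arguments.
Unset Strict Implicit.
Unset Printing Implicit Defensive.

Import Order.TTheory GRing.Theory Num.Theory.
Import numFieldNormedType.Exports.

Local Open Scope classical_set_scope.
Local Open Scope ring_scope.

(* The Borel sigma-algebra of R^n is the one that the library puts on tuples,
   generated by the coordinate maps. *)
Notation Rn R n := (n.-tuple (measurableTypeR R)).

Section measure_aux.
Local Open Scope ereal_scope.

Lemma sum_semi_sigma_additive d (T : measurableType d) (R : realType)
    (I : finType) (P : pred I) (w : I -> R) (m : I -> set T -> \bar R) :
  (forall i, P i -> (0 <= w i)%R) ->
  (forall i A, P i -> measurable A -> 0 <= m i A) ->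
  (forall i, P i -> semi_sigma_additive (m i)) ->
  semi_sigma_additive (fun A => \sum_(i | P i) (w i)%:E * m i A).
Proof.
move=> w0 m0 ms F mF tF mUF.
under eq_fun => k do rewrite exchange_big/=.
apply: cvg_nnesum => [i Pi|i Pi].
  by apply: nearW => k; apply: sume_ge0 => j _; rewrite mule_ge0 ?lee_fin ?w0
    ?m0.
under eq_fun => k.
  rewrite -ge0_sume_distrr; last by move=> j _; rewrite m0.
  over.
by apply: cvgeZl => //; exact: ms.
Qed.

Lemma product_sigma_finite d1 d2 (T1 : measurableType d1)
    (T2 : measurableType d2) (R : realType)
    (m1 : {sigma_finite_measure set T1 -> \bar R})
    (m2 : {sigma_finite_measure set T2 -> \bar R}) :
  sigma_finite setT (m1 \x m2).
Proof.
have /sigma_finiteP[F [TF ndF Foo]] := sigma_finiteT m1.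
have /sigma_finiteP[G [TG ndG Goo]] := sigma_finiteT m2.
exists (fun k => F k `*` G k).
  rewrite -setXTT TF TG predeqE => -[x y]; split.
    move=> [/= [i _ Fix] [j _ Gjy]]; exists (maxn i j) => //; split.
    - by move: x Fix; exact/subsetPset/ndF/leq_maxl.
    - by move: y Gjy; exact/subsetPset/ndG/leq_maxr.
  by move=> [i _ []/= ? ?]; split; exists i.
move=> k; have [? ?] := Foo k; have [? ?] := Goo k.
split; first exact: measurableX.
by rewrite product_measure1E// lte_mul_pinfty// ge0_fin_numE.
Qed.

End measure_aux.

Section lebesgue_cons.
Local Open Scope ereal_scope.
Context {R : realType} (n : nat).
Variable mu : {sigma_finite_measure set (Rn R n) -> \bar R}.

Definition tcons (z : measurableTypeR R * Rn R n) : Rn R n.+1 :=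
  [tuple of z.1 :: z.2].

Lemma measurable_tcons : measurable_fun setT tcons.
Proof. exact: measurable_cons. Qed.

Definition lebesgue_cons : set (Rn R n.+1) -> \bar R :=
  pushforward (@lebesgue_measure R \x mu) tcons.

Let lebesgue_cons0 : lebesgue_cons set0 = 0.
Proof. by rewrite /lebesgue_cons /pushforward preimage_set0 measure0. Qed.

Let lebesgue_cons_ge0 A : 0 <= lebesgue_cons A.
Proof. by rewrite /lebesgue_cons /pushforward measure_ge0. Qed.

Let lebesgue_cons_sigma_additive : semi_sigma_additive lebesgue_cons.
Proof. by apply: measure_semi_sigma_additive; exact: measurable_tcons. Qed.

HB.instance Definition _ := isMeasure.Build _ _ _ lebesgue_cons
  lebesgue_cons0 lebesgue_cons_ge0 lebesgue_cons_sigma_additive.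

Let lebesgue_cons_sigma_finite : sigma_finite setT lebesgue_cons.
Proof.
have [F TF Foo] := product_sigma_finite (@lebesgue_measure R) mu.
pose u (t : Rn R n.+1) : measurableTypeR R * Rn R n :=
  (tnth t ord0, [tuple of behead t]).
have mu' : measurable_fun setT u.
  apply: measurable_fun_pair; first exact: measurable_tnth.
  exact: measurable_behead.
have uK z : u (tcons z) = z.
  case: z => x t; rewrite /u /tcons /=; congr pair.
  exact/val_inj.
exists (fun k => u @^-1` F k).
  by rewrite -preimage_bigcup -TF preimage_setT.
move=> k; have [mFk Fkoo] := Foo k; split.
  by rewrite -[X in measurable X]setTI; exact: mu'.
rewrite /lebesgue_cons /pushforward (_ : _ @^-1` _ = F k)//.
by apply/seteqP; split => z; rewrite /preimage/= uK.
Qed.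

HB.instance Definition _ := Measure_isSigmaFinite.Build _ _ _ lebesgue_cons
  lebesgue_cons_sigma_finite.

End lebesgue_cons.

(* Lebesgue measure on R^n; on R^0 it is the unit mass at the only point. *)
Fixpoint lebesgue_Rn (R : realType) (n : nat) :
    {sigma_finite_measure set (Rn R n) -> \bar R} :=
  match n with
  | 0%N => \d_([tuple] : Rn R 0)
  | m.+1 => lebesgue_cons (lebesgue_Rn R m)
  end.

Section density.
Local Open Scope ereal_scope.
Context d (T : measurableType d) (R : realType).

Record density (mu : {measure set T -> \bar R}) := Density {
  density_fun :> T -> R ;
  measurable_density : measurable_fun setT density_fun ;
  density_ge0 : forall x, (0 <= density_fun x)%R ;
  integral_density : \int[mu]_x (density_fun x)%:E = 1 }.

Variables (mu : {measure set T -> \bar R}) (f : density mu).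

Definition density_prob (A : set T) : \bar R := \int[mu]_(x in A) (f x)%:E.

Let density_prob0 : density_prob set0 = 0.
Proof. by rewrite /density_prob integral_set0. Qed.

Let density_prob_ge0 A : 0 <= density_prob A.
Proof. by apply: integral_ge0 => x _; rewrite lee_fin density_ge0. Qed.

Let density_prob_sigma_additive : semi_sigma_additive density_prob.
Proof.
move=> F mF tF mUF; rewrite /density_prob ge0_integral_bigcup//=.
- by apply: is_cvg_ereal_nneg_natsum_cond => k _ _; exact: density_prob_ge0.
- by apply/measurable_EFinP/measurable_funTS; exact: measurable_density.
- by move=> x _; rewrite lee_fin density_ge0.
Qed.

HB.instance Definition _ := isMeasure.Build _ _ _ density_prob
  density_prob0 density_prob_ge0 density_prob_sigma_additive.

Let density_prob_setT : density_prob setT = 1.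
Proof. exact: integral_density. Qed.

HB.instance Definition _ := Measure_isProbability.Build _ _ _ density_prob
  density_prob_setT.

End density.

Lemma density_R0 (R : realType) (f : density (lebesgue_Rn R 0)) : f [tuple] = 1.
Proof.
have := integral_density f; rewrite integral_dirac//= ?diracT ?mul1e.
  by case.
by apply/measurable_EFinP; exact: measurable_density.
Qed.

Section vectors.
Context {R : realType}.

Definition sub_Rn n (x y : Rn R n) : Rn R n :=
  [tuple tnth x i - tnth y i | i < n].

Definition norm_Rn n (x : Rn R n) : R := Num.sqrt (\sum_(i < n) tnth x i ^+ 2).

Definition support_Rn n (x : Rn R n) : {set 'I_n} :=
  [set i | tnth x i != 0]%SET.

Definition ell0 n (p : nat) : set (Rn R n) :=
  [set x | (#|support_Rn x| <= p)%N].

(* R^S is identified with R^#|S| by listing S in increasing order.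
   [coord_proj S] is the coordinate projection R^n -> R^S, and [zero_pad]
   extends a vector of R^S by zero outside S (for i outside S, [index] runs off
   the end of the vector). *)
Definition coord_proj n (S : {set 'I_n}) (x : Rn R n) : Rn R #|S| :=
  [tuple tnth x (enum_val j) | j < #|S|].

Definition zero_pad n (S : {set 'I_n}) (t : Rn R #|S|) : Rn R n :=
  [tuple nth 0 t (index i (enum S)) | i < n].

Lemma zero_padN n (S : {set 'I_n}) (t : Rn R #|S|) i :
  i \notin S -> tnth (zero_pad t) i = 0.
Proof.
move=> iS; rewrite tnth_mktuple nth_default// size_tuple.
by rewrite leqNgt cardE index_mem mem_enum.
Qed.

Lemma measurable_zero_pad n (S : {set 'I_n}) :
  measurable_fun setT (@zero_pad n S).
Proof.
apply/measurable_fun_tnthP => i.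
have [iS|iS] := boolP (i \in S); last first.
  rewrite (_ : _ \o _ = cst 0); first exact: measurable_cst.
  by apply/funext => t /=; rewrite zero_padN.
have iS' : (index i (enum S) < #|S|)%N by rewrite cardE index_mem mem_enum.
rewrite (_ : _ \o _ = @tnth _ _ ^~ (Ordinal iS')); first exact: measurable_tnth.
by apply/funext => t /=; rewrite tnth_mktuple (tnth_nth 0).
Qed.

Lemma zero_padK n (S : {set 'I_n}) : cancel (@zero_pad n S) (@coord_proj n S).
Proof.
move=> t; apply/eq_from_tnth => j; rewrite !tnth_mktuple.
rewrite (enum_val_nth (enum_val j)) index_uniq ?enum_uniq -?cardE//.
by rewrite (tnth_nth 0).
Qed.

End vectors.
Arguments coord_proj {R n} S x.

Section normal_Rn.
Local Open Scope ereal_scope.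
Context {R : realType}.

Definition normal_pdf_Rn n (theta x : Rn R n) : R :=
  (\prod_(i < n) normal_pdf (tnth theta i) 1 (tnth x i))%R.

Lemma measurable_normal_pdf_Rn n (theta : Rn R n) :
  measurable_fun setT (normal_pdf_Rn theta).
Proof.
apply: measurable_prod => i _.
apply: measurableT_comp; first exact: measurable_normal_pdf.
exact: measurable_tnth.
Qed.

Lemma normal_pdf_Rn_ge0 n (theta x : Rn R n) : (0 <= normal_pdf_Rn theta x)%R.
Proof. by apply: prodr_ge0 => i _; exact: normal_pdf_ge0. Qed.

Lemma integral_normal_pdf_Rn n (theta : Rn R n) :
  \int[lebesgue_Rn R n]_x (normal_pdf_Rn theta x)%:E = 1.
Proof.
elim: n theta => [|n IH] theta.
  rewrite integral_dirac//= ?diracT ?mul1e; last first.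
    by apply/measurable_EFinP; exact: measurable_normal_pdf_Rn.
  by rewrite /normal_pdf_Rn big_ord0.
rewrite /= ge0_integral_pushforward//=; last 3 first.
- exact: measurable_tcons.
- by apply/measurable_EFinP; exact: measurable_normal_pdf_Rn.
- by move=> x _; rewrite lee_fin normal_pdf_Rn_ge0.
rewrite preimage_setT fubini_tonelli1//=; last 2 first.
- apply/measurable_EFinP; apply: measurableT_comp.
    exact: measurable_normal_pdf_Rn.
  exact: measurable_tcons.
- by move=> x; rewrite lee_fin normal_pdf_Rn_ge0.
rewrite -[RHS](integral_normal_pdf (tnth theta ord0) 1).
apply: eq_integral => x _; rewrite /fubini_F /=.
transitivity (\int[lebesgue_Rn R n]_t ((normal_pdf (tnth theta ord0) 1 x)%:E *
    (normal_pdf_Rn [tuple of behead theta] t)%:E)).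
  apply: eq_integral => t _; rewrite /normal_pdf_Rn big_ord_recl EFinM.
  rewrite tnth0; congr (_ * (_)%:E); apply: eq_bigr => i _.
  by rewrite tnthS [in LHS](tuple_eta theta) tnthS.
rewrite ge0_integralZl_EFin ?IH ?mule1//.
- by move=> t _; rewrite lee_fin normal_pdf_Rn_ge0.
- by apply/measurable_EFinP; exact: measurable_normal_pdf_Rn.
- exact: normal_pdf_ge0.
Qed.

Definition normal_density_Rn n (theta : Rn R n) : density (lebesgue_Rn R n) :=
  Density (measurable_normal_pdf_Rn theta) (normal_pdf_Rn_ge0 theta)
    (integral_normal_pdf_Rn theta).

(* The distribution N_n(theta, I). *)
Definition normal_Rn n (theta : Rn R n) : probability (Rn R n) R :=
  density_prob (normal_density_Rn theta).

End normal_Rn.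

(* The ingredients of the prior on R^n: the distribution of the dimension and,
   for each p, the density on R^p shared by all the supports S with #|S| = p.
   Only the values at p <= n are used; the density on R^0 is 1 by
   [density_R0]. *)
Record sparse_prior (R : realType) (n : nat) := SparsePrior {
  dim_pmf : nat -> R ;
  dim_pmf_gt0 : forall p, (p <= n)%N -> 0 < dim_pmf p ;
  dim_pmf_sum1 : \sum_(p < n.+1) dim_pmf p = 1 ;
  slab : forall p, density (lebesgue_Rn R p) }.

Section prior.
Local Open Scope ereal_scope.
Context {R : realType} (n : nat).
Variable Pi : sparse_prior R n.

Definition prior_given_dim (p : nat) (A : set (Rn R n)) : \bar R :=
  \sum_(S : {set 'I_n} | #|S| == p)
     ('C(n, p)%:R^-1)%:E *
     pushforward (density_prob (slab Pi #|S|)) (@zero_pad R n S) A.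

Definition prior (A : set (Rn R n)) : \bar R :=
  \sum_(p < n.+1) (dim_pmf Pi p)%:E * prior_given_dim p A.

Let prior_given_dim_ge0 p A : 0 <= prior_given_dim p A.
Proof.
apply: sume_ge0 => S _; apply: mule_ge0; first by rewrite lee_fin invr_ge0.
by apply: measure_ge0; exact: measurable_zero_pad.
Qed.

Let prior0 : prior set0 = 0.
Proof.
rewrite /prior big1// => p _; rewrite /prior_given_dim big1 ?mule0// => S _.
by rewrite /pushforward preimage_set0 measure0 mule0.
Qed.

Let prior_ge0 A : 0 <= prior A.
Proof.
apply: sume_ge0 => p _; apply: mule_ge0 => //.
by rewrite lee_fin ltW// dim_pmf_gt0// -ltnS.
Qed.

Let prior_sigma_additive : semi_sigma_additive prior.
Proof.
apply: sum_semi_sigma_additive => [p _|//|p _].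
  by rewrite ltW// dim_pmf_gt0// -ltnS.
apply: sum_semi_sigma_additive => [S _|S A _ _|S _]; first by rewrite invr_ge0.
  by apply: measure_ge0; exact: measurable_zero_pad.
by apply: measure_semi_sigma_additive; exact: measurable_zero_pad.
Qed.

HB.instance Definition _ := isMeasure.Build _ _ _ prior
  prior0 prior_ge0 prior_sigma_additive.

Let prior_setT : prior setT = 1.
Proof.
rewrite /prior -[RHS]/(1%R%:E) -(dim_pmf_sum1 Pi) -sumEFin.
apply: eq_bigr => p _.
rewrite (_ : prior_given_dim p setT = 1) ?mule1// /prior_given_dim.
under eq_bigr do rewrite /pushforward preimage_setT probability_setT mule1.
rewrite sumEFin sumr_const.
have -> : #|[pred S : {set 'I_n} | #|S| == p]| = 'C(n, p).
  have := card_draws 'I_n p; rewrite card_ord => <-.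
  by apply: eq_card => S; rewrite !inE.
by rewrite -[X in X%:E]mulr_natl divff// pnatr_eq0 -lt0n bin_gt0 -ltnS.
Qed.

HB.instance Definition _ := Measure_isProbability.Build _ _ _ prior prior_setT.

Definition posterior (x : Rn R n) (B : set (Rn R n)) : \bar R :=
  (\int[prior]_(theta in B) (normal_pdf_Rn theta x)%:E) /
  (\int[prior]_theta (normal_pdf_Rn theta x)%:E).

End prior.

(* Main.v *)
(* Fix [theta0] and a set [S0] of [p_n] coordinates containing its support.  A
   posterior probability is at most 1, hence at most the square root of any of
   its upper bounds, so the posterior mass of the far region is bounded by the
   sum over the models [S] of the square roots of the posterior odds of
   "[S] and far from [theta0]" against [S0].  The comparison of the slabs along
   [S], [S :&: S0], [S0] and completion of the square reduce these odds to
   products over the coordinates of exp (3/4 z^2), z the standard normal noise;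
   the square root makes their expectation finite.  The distance contributes
   exp (- T^2 / 16), and the condition a >= 1 on the prior of the dimension
   beats the number of models of each size. *)
Require Import Defs.
From mathcomp Require Import all_boot all_order all_algebra.
From mathcomp Require Import all_classical all_reals all_analysis.
From mathcomp Require Import measurable_realfun ring lra.

Import Order.TTheory GRing.Theory Num.Theory.
Import numFieldNormedType.Exports.

Local Open Scope classical_set_scope.
Local Open Scope ring_scope.

(** * Integrals against densities, finite mixtures and product functions *)

Section integration.
Local Open Scope ereal_scope.

(** The integral of a nonnegative function is a supremum over the simple functions below it, and a
    larger function has more of them. It serves in particular to integrate the posterior over the
    observation. *)
Lemma ge0_le_integral_nonmeasurable d (T : measurableType d) (R : realType)
    (mu : {measure set T -> \bar R}) (f g : T -> \bar R) :
  (forall x, 0 <= f x) -> (forall x, f x <= g x) ->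
  \int[mu]_x f x <= \int[mu]_x g x.
Proof.
move=> f0 fg; rewrite !ge0_integralTE//; last by move=> x; exact: le_trans (fg x).
apply: le_ereal_sup => _ [h hf <-]; exists h => // x.
exact: le_trans (fg x).
Qed.

Import HBNNSimple.

(** Simple functions reduce to indicators, where this is the definition of [density_prob]; monotone
    convergence on both sides does the rest. *)
Lemma ge0_integral_density_prob d (T : measurableType d) (R : realType)
    (mu : {measure set T -> \bar R}) (g : density mu) (f : T -> \bar R) :
  measurable_fun setT f -> (forall x, 0 <= f x) ->
  \int[density_prob g]_x f x = \int[mu]_x (f x * (g x)%:E).
Proof.
move=> mf f0; pose h := nnsfun_approx measurableT mf.
have mg : measurable_fun setT (EFin \o g).
  by apply/measurable_EFinP; exact: measurable_density.
have g0 x : 0 <= (g x)%:E by rewrite lee_fin density_ge0.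
have hf x : (h n x)%:E @[n --> \oo] --> f x by exact: cvg_nnsfun_approx.
have ndh x : {homo (fun n => (h n x)%:E) : m n / (m <= n)%N >-> m <= n}.
  by move=> m n mn; rewrite lee_fin; exact/lefP/nd_nnsfun_approx.
have hn n : \int[density_prob g]_x (h n x)%:E = \int[mu]_x ((h n x)%:E * (g x)%:E).
  have mI (A : set T) r : measurable A ->
      measurable_fun setT (fun x : T => (r * \1_A x)%:E).
    by move=> mA; apply/measurable_EFinP/measurable_funM.
  under [LHS]eq_integral do rewrite fimfunE -fsumEFin//.
  under [RHS]eq_integral do rewrite (fimfunE (h n)) -fsumEFin//.
  rewrite ge0_integral_fsum//; last 2 first.
  - by move=> r; exact: mI.
  - by move=> r x _; exact: nnfun_muleindic_ge0.
  under [RHS]eq_integral => x _.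
    rewrite ge0_mule_fsuml; last by move=> r; exact: nnfun_muleindic_ge0.
    over.
  rewrite ge0_integral_fsum//; last 2 first.
  - by move=> r; apply: emeasurable_funM => //; exact: mI.
  - by move=> r x _; rewrite mule_ge0// nnfun_muleindic_ge0.
  apply: eq_fsbigr => r /set_mem[y _ <-].
  under eq_integral do rewrite EFinM.
  under [RHS]eq_integral do rewrite EFinM -muleA.
  rewrite ge0_integralZl_EFin//=; last exact/measurable_EFinP.
  rewrite integral_indic//= setIT ge0_integralZl_EFin//; last 2 first.
  - by move=> x _; rewrite mule_ge0.
  - by apply: emeasurable_funM => //; exact/measurable_EFinP.
  congr (_ * _); rewrite [LHS]integral_mkcond/=; apply: eq_integral => x _.
  rewrite patchE indicE/=; case: ifP => xA; rewrite ?mul1e ?mul0e//.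
transitivity (limn (fun n => \int[density_prob g]_x (h n x)%:E)).
  rewrite -monotone_convergence//.
  - by apply: eq_integral => x _; apply/esym/cvg_lim => //; exact: hf.
  - by move=> n; apply/measurable_EFinP.
  - by move=> n x _; rewrite lee_fin.
under eq_fun do rewrite hn.
rewrite -monotone_convergence//.
- apply: eq_integral => x _; apply/cvg_lim => //.
  by apply: cvgeZr => //; exact: hf.
- by move=> n; apply: emeasurable_funM => //; exact/measurable_EFinP.
- by move=> n x _; rewrite mule_ge0// lee_fin.
- by move=> x _ m n mn; rewrite lee_wpmul2r//; exact: ndh.
Qed.

Lemma ge0_integral_finite_mixture d (T : measurableType d) (R : realType)
    (I : finType) (w : I -> R) (m : I -> {measure set T -> \bar R})
    (mu : {measure set T -> \bar R}) (f : T -> \bar R) :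
  (forall i, (0 <= w i)%R) ->
  (forall A, measurable A -> mu A = \sum_i (w i)%:E * m i A) ->
  measurable_fun setT f -> (forall x, 0 <= f x) ->
  \int[mu]_x f x = \sum_i (w i)%:E * \int[m i]_x f x.
Proof.
move=> w0 muE mf f0.
(* Enumerating by [nth] needs a default element, so the empty index type, where [mu] vanishes, is
   settled first. *)
have [i0|I0] := pickP (fun _ : I => true); last first.
  have -> : \int[mu]_x f x = \int[mzero]_x f x.
    apply: eq_measure_integral => A mA _.
    by rewrite muE// big1// => i; have := I0 i.
  by rewrite integral_measure_zero big1// => i; have := I0 i.
move=> _; pose e k := nth i0 (enum I) k.
pose m' k : {measure set T -> \bar R} :=
  mscale (NngNum (w0 (e k))) (m (e k)).
have sumE (F : I -> \bar R) : \sum_i F i = \sum_(k < #|I|) F (e k).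
  rewrite -big_enum/= (big_nth i0) -cardE big_mkord.
  by apply: eq_bigr.
rewrite sumE (eq_measure_integral (msum m' #|I|)); last first.
  move=> A mA _; rewrite muE// sumE /msum.
  by apply: eq_bigr => k _; rewrite /m' /mscale.
rewrite ge0_integral_measure_sum//; apply: eq_bigr => k _.
by rewrite ge0_integral_mscale.
Qed.

(** Tonelli, peeling off the first coordinate. *)
Lemma integral_prod_Rn (R : realType) (n : nat) (f : 'I_n -> R -> R)
    (c : 'I_n -> R) :
  (forall i, measurable_fun setT (f i : measurableTypeR R -> R)) ->
  (forall i x, (0 <= f i x)%R) ->
  (forall i, \int[lebesgue_measure]_x (f i x)%:E = (c i)%:E) ->
  \int[lebesgue_Rn R n]_x (\prod_(i < n) f i (tnth x i))%:E = (\prod_i c i)%:E.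
Proof.
elim: n f c => [|n IH] f c mf f0 fc.
  under eq_integral do rewrite big_ord0.
  by rewrite integral_dirac//= ?diracT ?mul1e ?big_ord0.
have mprod k (g : 'I_k -> R -> R) :
    (forall i, measurable_fun setT (g i : measurableTypeR R -> R)) ->
    measurable_fun setT (fun x : Rn R k => \prod_(i < k) g i (tnth x i))%R.
  move=> mg; apply: measurable_prod => i _.
  by apply: measurableT_comp; [exact: mg|exact: measurable_tnth].
rewrite /= ge0_integral_pushforward//=; last 3 first.
- exact: measurable_tcons.
- by apply/measurable_EFinP; exact: mprod.
- by move=> x _; rewrite lee_fin prodr_ge0.
rewrite preimage_setT fubini_tonelli1//=; last 2 first.
- apply/measurable_EFinP; exact: (measurableT_comp (mprod _ _ mf) (@measurable_tcons _ _)).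
- by move=> x; rewrite lee_fin prodr_ge0.
rewrite big_ord_recl.
transitivity (\int[lebesgue_measure]_x ((f ord0 x)%:E *
    (\prod_(i < n) c (lift ord0 i))%:E)).
  apply: eq_integral => x _; rewrite /fubini_F /=.
  rewrite -(IH (fun i => f (lift ord0 i)))//.
  rewrite -ge0_integralZl_EFin//.
  - apply: eq_integral => t _; rewrite big_ord_recl EFinM tnth0.
    by congr (_ * (_)%:E); apply: eq_bigr => i _; rewrite tnthS.
  - by move=> t _; rewrite lee_fin prodr_ge0.
  - by apply/measurable_EFinP; exact: (mprod _ (fun i => f (lift ord0 i))).
have c0 : (0 <= \prod_(i < n) c (lift ord0 i))%R.
  apply: prodr_ge0 => i _; rewrite -lee_fin -fc.
  by apply: integral_ge0 => x _; rewrite lee_fin.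
rewrite ge0_integralZr ?lee_fin//.
- by rewrite fc.
- by apply/measurable_EFinP.
- by move=> x _; rewrite lee_fin.
Qed.

End integration.

(** * Coordinate projection and zero padding *)

Section vectors.
Context {R : realType} {n : nat}.
Implicit Types (x : Rn R n) (S : {set 'I_n}) (i : 'I_n).

Lemma sqr_norm_Rn m (y : Rn R m) : norm_Rn y ^+ 2 = \sum_(i < m) tnth y i ^+ 2.
Proof. by rewrite sqr_sqrtr//; apply: sumr_ge0 => i _; exact: sqr_ge0. Qed.

Lemma zero_pad_enum_val S (t : Rn R #|S|) j :
  tnth (zero_pad t) (enum_val j) = tnth t j.
Proof. by rewrite -[in RHS](zero_padK t) [RHS]tnth_mktuple. Qed.

Lemma zero_pad_coord_proj S x :
  support_Rn x \subset S -> zero_pad (coord_proj S x) = x.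
Proof.
move=> xS; apply/eq_from_tnth => i; have [iS|iS] := boolP (i \in S).
  by rewrite -(enum_rankK_in iS iS) zero_pad_enum_val tnth_mktuple.
rewrite zero_padN//; apply/esym/eqP.
by apply: contraNT iS => xi0; apply: (fintype.subsetP xS); rewrite inE.
Qed.

Lemma sqr_norm_coord_proj S x :
  norm_Rn (coord_proj S x) ^+ 2 = \sum_(i in S) tnth x i ^+ 2.
Proof.
rewrite sqr_norm_Rn [RHS]big_enum_val/=.
by apply: eq_bigr => j _; rewrite tnth_mktuple.
Qed.

Lemma sqr_norm_sub_coord_proj S x (y : Rn R n) :
  norm_Rn (sub_Rn (coord_proj S x) (coord_proj S y)) ^+ 2 =
  \sum_(i in S) (tnth x i - tnth y i) ^+ 2.
Proof.
rewrite sqr_norm_Rn [RHS]big_enum_val/=.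
by apply: eq_bigr => j _; rewrite !tnth_mktuple.
Qed.

End vectors.

(** * Comparison of slabs on different supports *)

Section slabs.
Context {R : realType} {n : nat}.
Variables (Pi : sparse_prior R n) (c1 : R).
Hypothesis slab_gt0 : forall p, (p <= n)%N ->
  forall theta : Rn R p, 0 < slab Pi p theta.
Hypothesis log_slab_var : forall (S : {set 'I_n}) (theta theta' : Rn R #|S|),
  ln (slab Pi #|S| theta) - ln (slab Pi #|S| theta')
    <= c1 * #|S|%:R + 64^-1 * norm_Rn (sub_Rn theta theta') ^+ 2.
Hypothesis log_slab_proj : forall S' S : {set 'I_n}, S' \subset S ->
  forall theta : Rn R #|S|,
  `| ln (slab Pi #|S| theta)
     - ln (slab Pi #|S'| (coord_proj S' (zero_pad theta))) |
    <= c1 * #|S|%:R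
       + 64^-1 * norm_Rn (coord_proj (S :\: S')%SET (zero_pad theta)) ^+ 2.

(** Equal arguments on the full support leave [0 <= c1 * n]. *)
Lemma slab_const_ge0 : (0 < n)%N -> 0 <= c1.
Proof.
move=> n0; have := log_slab_var [set: 'I_n] [tuple 0 | i < _] [tuple 0 | i < _].
rewrite subrr sqr_norm_Rn big1 ?mulr0 ?addr0; last first.
  by move=> i _; rewrite !tnth_mktuple subrr expr0n.
by rewrite pmulr_lge0// ltr0n cardsT card_ord.
Qed.

(* Going from [S] to [S0] through [S :&: S0] splits the squared distance exactly
   and pays [c1 * #|S|] only once, which the factor [2 * c1] in the condition on
   [b] can absorb after taking square roots. *)
Lemma slab_ratio : 0 <= c1 ->
  forall (S S0 : {set 'I_n}) (t : Rn R #|S|) (u : Rn R #|S0|),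
  slab Pi #|S| t <= slab Pi #|S0| u
    * expR (c1 * (#|S|%:R + 2 * #|S0|%:R))
    * expR (64^-1 * \sum_i (tnth (zero_pad t) i - tnth (zero_pad u) i) ^+ 2).
Proof.
move=> c0 S S0 t u; pose I := (S :&: S0)%SET.
have le_n (A : {set 'I_n}) : (#|A| <= n)%N by rewrite -[leqRHS]card_ord max_card.
have gt0 (A : {set 'I_n}) (v : Rn R #|A|) :
    0 < slab Pi #|A| v by exact/slab_gt0/le_n.
have IS : I \subset S by exact: subsetIl.
have IS0 : I \subset S0 by exact: subsetIr.
have /ler_normlP[_ h1] := log_slab_proj _ _ IS t.
have h2 := log_slab_var I (coord_proj I (zero_pad t)) (coord_proj I (zero_pad u)).
have /ler_normlP[h3 _] := log_slab_proj _ _ IS0 u.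
rewrite sqr_norm_coord_proj in h1; rewrite sqr_norm_coord_proj in h3.
rewrite sqr_norm_sub_coord_proj in h2.
(* As [I] lies in [S0], the move within [I] is charged to [S0]; with the move from [I] to [S0] this
   makes [2 * #|S0|]. *)
have cI : c1 * #|I|%:R <= c1 * #|S0|%:R.
  by rewrite ler_wpM2l// ler_nat subset_leq_card.
rewrite -!mulrA -!expRD -ler_ln ?posrE ?mulr_gt0 ?expR_gt0//.
rewrite lnM ?posrE ?expR_gt0// expRK.
have -> : \sum_i (tnth (zero_pad t) i - tnth (zero_pad u) i) ^+ 2 =
    \sum_(i in I) (tnth (zero_pad t) i - tnth (zero_pad u) i) ^+ 2 +
    \sum_(i in (S :\: I)%SET) tnth (zero_pad t) i ^+ 2 +
    \sum_(i in (S0 :\: I)%SET) tnth (zero_pad u) i ^+ 2.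
  rewrite [X in _ = X + _ + _]big_mkcond [X in _ = _ + X + _]big_mkcond.
  rewrite [X in _ = _ + X]big_mkcond -!big_split/=.
  apply: eq_bigr => i _; rewrite !inE.
  have [iS|iS] := boolP (i \in S); have [iS0|iS0] := boolP (i \in S0) => //=;
    by rewrite ?(zero_padN _ iS) ?(zero_padN _ iS0) ?subr0 ?sub0r ?sqrrN
      ?expr0n/= ?addr0 ?add0r.
move: h1 h2 h3 cI.
set a1 := \sum_(i in (S :\: I)%SET) _; set a2 := \sum_(i in I) _.
set a3 := \sum_(i in (S0 :\: I)%SET) _; lra.
Qed.

End slabs.

(** * One-dimensional Gaussian inequalities *)

Section one_dim.
Context {R : realType}.
Implicit Types m s x h z : R.

(** The normalization [sqrt (8 pi)] is below 6 because [pi < 4]. *)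
Lemma normal_pdf2_lb m x :
  expR (- (x - m) ^+ 2 / 8) <= 6 * normal_pdf m 2 x.
Proof.
rewrite normal_pdfE// /normal_peak /normal_fun.
rewrite (_ : 2 ^+ 2 *+ 2 = 8); last by ring.
rewrite mulrA ler_peMl ?expR_ge0//.
have /andP[p0 p2] := @pihalf_02 R.
rewrite ler_pdivlMr ?mul1r; last by rewrite sqrtr_gt0; nra.
have <- : Num.sqrt (6 ^+ 2) = 6 :> R by rewrite sqrtr_sqr ger0_norm.
by rewrite ler_wsqrtr//; nra.
Qed.

(** The peak [1 / sqrt (pi / 2)] is at most 1 because [pi >= 2]. *)
Lemma normal_pdf_half_ub m x : normal_pdf m 2^-1 x <= expR (- 2 * (x - m) ^+ 2).
Proof.
rewrite normal_pdfE// ?invr_eq0// /normal_peak /normal_fun.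
rewrite (_ : - (x - m) ^+ 2 / (2^-1 ^+ 2 *+ 2) = - 2 * (x - m) ^+ 2); last by field.
rewrite ler_piMl ?expR_ge0//.
have p2 := @pi_ge2 R.
rewrite invf_le1; last by rewrite sqrtr_gt0; lra.
by rewrite -[leLHS](sqrtr1 R) ler_wsqrtr//; lra.
Qed.

(* 23/64 = 1/2 - 1/64 - 1/8: the likelihood, the slab ratio, and a reserve of
   [h ^+ 2 / 8] that yields the decay in the distance to [theta0]. *)
Lemma numerator_factor z h :
  expR (h * z - 23 / 64 * h ^+ 2)
    <= expR (3 / 4 * z ^+ 2) * expR (- (h - 3 / 2 * z) ^+ 2 / 8).
Proof.
rewrite -expRD ler_expR.
(* The exponents differ by [15/64 ((h - 4/3 z)^2 + 2/9 z^2)]. *)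
have := sqr_ge0 (h - 4 / 3 * z); have := sqr_ge0 z; lra.
Qed.

(* 33/64 = 1/2 + 1/64: the likelihood and the slab ratio. *)
Lemma denominator_factor z h :
  expR (- 2 * (h - 32 / 33 * z) ^+ 2) <= expR (h * z - 33 / 64 * h ^+ 2).
Proof.
rewrite ler_expR.
(* The centre [32/33 z] is the maximizer: the right exponent equals
   [16/33 z^2 - 33/64 (h - 32/33 z)^2], and [33/64 <= 2]. *)
have := sqr_ge0 (h - 32 / 33 * z); have := sqr_ge0 z; lra.
Qed.

(** As [3/8 - 1/2 = - 1/8], the exponent becomes that of standard deviation 2. The weight [3/4],
    before the square root, would exceed [1/2] and diverge. *)
Lemma normal_pdf_inflate m x :
  expR (3 / 8 * (x - m) ^+ 2) * normal_pdf m 1 x = 2 * normal_pdf m 2 x.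
Proof.
rewrite !normal_pdfE// /normal_peak /normal_fun.
have -> : 2 ^+ 2 * pi *+ 2 = 2 ^+ 2 * (1 ^+ 2 * pi *+ 2) :> R by ring.
rewrite sqrtrM ?sqr_ge0// sqrtr_sqr ger0_norm// invfM.
rewrite !mulrA divff// mul1r mulrAC -expRD mulrC.
by congr (_ * expR _); field.
Qed.

End one_dim.

(** * The Gaussian likelihood on R^n *)

Lemma normal_pdf_Rn_shift (R : realType) n (theta0 theta x : Rn R n) :
  normal_pdf_Rn theta x = normal_pdf_Rn theta0 x * \prod_i
    expR ((tnth theta i - tnth theta0 i) * (tnth x i - tnth theta0 i)
          - 2^-1 * (tnth theta i - tnth theta0 i) ^+ 2).
Proof.
rewrite /normal_pdf_Rn -big_split/=; apply: eq_bigr => i _.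
rewrite !normal_pdfE// /normal_fun -[RHS]mulrA -expRD.
by congr (_ * expR _); field.
Qed.

(** Transfers measurability in the observation to measurability in the parameter. *)
Lemma normal_pdf_Rn_sym (R : realType) n (theta x : Rn R n) :
  normal_pdf_Rn theta x = normal_pdf_Rn x theta.
Proof.
apply: eq_bigr => i _; rewrite !normal_pdfE// /normal_fun.
by congr (_ * expR _); rewrite -opprB sqrrN.
Qed.

Lemma normal_pdf_Rn_gt0 (R : realType) n (theta x : Rn R n) :
  0 < normal_pdf_Rn theta x.
Proof.
apply: prodr_gt0 => i _; rewrite normal_pdfE//.
by rewrite mulr_gt0 ?normal_peak_gt0 ?expR_gt0.
Qed.

(** Each factor has peak [1 / sqrt (2 pi) <= 1]. This keeps the denominator of the posterior
    finite. *)
Lemma normal_pdf_Rn_le1 (R : realType) n (theta x : Rn R n) :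
  normal_pdf_Rn theta x <= 1.
Proof.
apply: prodr_ile1 => i _; rewrite normal_pdf_ge0/=.
apply: le_trans (normal_pdf_ub _ _ _) _ => //.
have p2 := @pi_ge2 R; rewrite /normal_peak invf_le1; last by rewrite sqrtr_gt0; lra.
by rewrite -[leLHS](sqrtr1 R) ler_wsqrtr//; lra.
Qed.

(** * The prior as a mixture over supports *)

Definition support_weight {R : realType} {n} (Pi : sparse_prior R n)
  (S : {set 'I_n}) : R := dim_pmf Pi #|S| / 'C(n, #|S|)%:R.

Section prior_integral.
Context {R : realType} {n : nat} (Pi : sparse_prior R n).

Lemma support_card_le (S : {set 'I_n}) : (#|S| <= n)%N.
Proof. by rewrite -[leqRHS]card_ord max_card. Qed.

Lemma support_weight_gt0 S : 0 < support_weight Pi S.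
Proof.
by rewrite divr_gt0 ?dim_pmf_gt0 ?support_card_le// ltr0n bin_gt0 support_card_le.
Qed.

Local Open Scope ereal_scope.

Lemma priorE (A : set (Rn R n)) : prior Pi A =
  \sum_(S : {set 'I_n}) (support_weight Pi S)%:E *
    pushforward (density_prob (slab Pi #|S|)) (@zero_pad R n S) A.
Proof.
(* Sets are grouped by size; [inord] loses nothing since [#|S| <= n]. *)
rewrite /prior (partition_big (fun S : {set 'I_n} => inord #|S| : 'I_n.+1) xpredT)//=.
apply: eq_bigr => p _.
have pS (S : {set 'I_n}) : (inord #|S| == p :> 'I_n.+1) = (#|S| == p).
  by rewrite -val_eqE/= inordK// ltnS support_card_le.
rewrite /prior_given_dim ge0_sume_distrr; last first.
  move=> S _; apply: mule_ge0; first by rewrite lee_fin invr_ge0.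
  by apply: measure_ge0; exact: measurable_zero_pad.
apply: eq_big => S; first by rewrite pS.
by move=> /eqP <-; rewrite muleA -EFinM.
Qed.

Lemma ge0_integral_prior (f : Rn R n -> \bar R) :
  measurable_fun setT f -> (forall x, 0 <= f x) ->
  \int[prior Pi]_x f x = \sum_(S : {set 'I_n}) (support_weight Pi S)%:E *
    \int[lebesgue_Rn R #|S|]_t (f (zero_pad t) * (slab Pi #|S| t)%:E).
Proof.
move=> mf f0.
have mpad (S : {set 'I_n}) := @measurable_zero_pad R n S.
pose m (S : {set 'I_n}) : {measure set (Rn R n) -> \bar R} :=
  pushforward (density_prob (slab Pi #|S|)) (@zero_pad R n S).
rewrite (@ge0_integral_finite_mixture _ _ _ _ (support_weight Pi) (m mpad))//.
- apply: eq_bigr => S _; congr (_ * _).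
  rewrite ge0_integral_pushforward//; last exact: mpad.
  rewrite preimage_setT ge0_integral_density_prob//.
  - exact: measurableT_comp (mpad S).
  - by move=> t; exact: f0.
- by move=> S; exact/ltW/support_weight_gt0.
- by move=> A _; exact: priorE.
Qed.

End prior_integral.

(** * Gaussian reference integrals and the expected noise *)

(** Read from right to left, it turns a constant into an integral, so that bounding a slab integral
    becomes a pointwise comparison with a Gaussian. *)
Lemma integral_scaled_normal_pdf_prod (R : realType) (k : nat) (m : 'I_k -> R)
    (s C : R) : 0 <= C ->
  (\int[lebesgue_Rn R k]_t (C * \prod_(j < k) normal_pdf (m j) s (tnth t j))%:E
   = C%:E)%E.
Proof.
move=> C0.
have mf (j : 'I_k) : measurable_fun setT
    (normal_pdf (m j) s : measurableTypeR R -> R).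
  exact: measurable_normal_pdf.
under eq_integral do rewrite EFinM.
rewrite ge0_integralZl_EFin//.
- rewrite (@integral_prod_Rn _ _ (fun j => normal_pdf (m j) s) (fun=> 1))//.
  + by rewrite big1_eq mule1.
  + by move=> j y; exact: normal_pdf_ge0.
  + by move=> j; rewrite integral_normal_pdf.
- by move=> t _; rewrite lee_fin prodr_ge0// => j _; exact: normal_pdf_ge0.
- apply/measurable_EFinP; apply: measurable_prod => j _.
  exact: (measurableT_comp (mf j) (@measurable_tnth _ (measurableTypeR R) _ j)).
Qed.

(* An upper bound for the square root of the posterior odds of the model [S]
   against the model [S0], without its dependence on the observation. *)
Definition amplitude {R : realType} {n} (Pi : sparse_prior R n) (c1 : R)
    (S0 : {set 'I_n}) (T : R) (S : {set 'I_n}) : R :=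
  Num.sqrt (support_weight Pi S / support_weight Pi S0)
  * expR (c1 / 2 * (#|S|%:R + 5 * #|S0|%:R)) * expR (- (T ^+ 2 / 16)) * 3 ^+ #|S|.

Lemma amplitude_ge0 {R : realType} {n} (Pi : sparse_prior R n) (c1 : R)
    (S0 : {set 'I_n}) (T : R) (S : {set 'I_n}) : 0 <= amplitude Pi c1 S0 T S.
Proof. by rewrite !mulr_ge0 ?sqrtr_ge0 ?expR_ge0 ?exprn_ge0. Qed.

Lemma measurable_noise {R : realType} {n} (theta : Rn R n) (A : {set 'I_n}) :
  measurable_fun setT (fun x : Rn R n =>
    \prod_(i in A) expR (3 / 8 * (tnth x i - tnth theta i) ^+ 2) : R).
Proof.
under eq_fun do rewrite big_mkcond.
apply: measurable_prod => i _; case: (i \in A) => //.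
have mi : measurable_fun setT (fun x : Rn R n =>
    3 / 8 * (tnth x i - tnth theta i) ^+ 2 : R).
  apply: measurable_funM => //; apply: measurable_funX; apply: measurable_funB => //.
  exact: measurable_tnth.
exact: (measurableT_comp (@measurable_expR R) mi).
Qed.

(** Each coordinate in [A] becomes twice a density of standard deviation 2; the others integrate to
    1. Below, [s i] is both the scale and the resulting mass. *)
Lemma integral_noise {R : realType} {n} (theta : Rn R n) (A : {set 'I_n}) :
  (\int[normal_Rn theta]_x
     (\prod_(i in A) expR (3 / 8 * (tnth x i - tnth theta i) ^+ 2))%:E
   = (2 ^+ #|A|)%:E)%E.
Proof.
rewrite ge0_integral_density_prob; last 2 first.
- by apply/measurable_EFinP; exact: measurable_noise.
- by move=> x; rewrite lee_fin prodr_ge0// => i _; exact: expR_ge0.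
pose s i : R := if i \in A then 2 else 1.
transitivity (\int[lebesgue_Rn R n]_x
    (\prod_i (s i * normal_pdf (tnth theta i) (s i) (tnth x i)))%:E)%E.
  apply: eq_integral => x _; rewrite -EFinM; congr EFin => /=.
  rewrite /normal_pdf_Rn [X in X * _]big_mkcond -big_split/=.
  apply: eq_bigr => i _; rewrite /s; case: ifP => _; rewrite ?mul1r//.
  exact: normal_pdf_inflate.
rewrite (@integral_prod_Rn _ _ (fun i y => s i * normal_pdf (tnth theta i) (s i) y) s).
- by rewrite /s -big_mkcond prodr_const.
- by move=> i; apply: measurable_funM => //; exact: measurable_normal_pdf.
- by move=> i y; rewrite mulr_ge0 ?normal_pdf_ge0// /s; case: ifP.
- move=> i; have s0 : 0 <= s i by rewrite /s; case: ifP.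
  under eq_integral do rewrite EFinM.
  rewrite ge0_integralZl_EFin//.
  + by rewrite integral_normal_pdf mule1.
  + by move=> y _; rewrite lee_fin normal_pdf_ge0.
  + by apply/measurable_EFinP; exact: measurable_normal_pdf.
Qed.

(** * Posterior mass away from the true parameter *)

Section posterior_bound.
Context {R : realType} {n : nat}.
Variables (Pi : sparse_prior R n) (c1 : R).
Hypothesis slab_gt0 : forall p, (p <= n)%N ->
  forall theta : Rn R p, 0 < slab Pi p theta.
Hypothesis slab_le : forall (S S0 : {set 'I_n}) (t : Rn R #|S|) (u : Rn R #|S0|),
  slab Pi #|S| t <= slab Pi #|S0| u
    * expR (c1 * (#|S|%:R + 2 * #|S0|%:R))
    * expR (64^-1 * \sum_i (tnth (zero_pad t) i - tnth (zero_pad u) i) ^+ 2).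

Variables (theta0 : Rn R n) (S0 : {set 'I_n}).
Hypothesis theta0S0 : support_Rn theta0 \subset S0.

(** The factor common to the numerator and denominator bounds, which cancels in the odds. *)
Let pivot (x : Rn R n) : R :=
  normal_pdf_Rn theta0 x * slab Pi #|S0| (coord_proj S0 theta0).

Let pivot_gt0 x : 0 < pivot x.
Proof. by rewrite mulr_gt0 ?normal_pdf_Rn_gt0 ?slab_gt0 ?support_card_le. Qed.

Let noise (S : {set 'I_n}) (x : Rn R n) : R :=
  \prod_(i in S :|: S0) expR (3 / 4 * (tnth x i - tnth theta0 i) ^+ 2).

Let theta0_out i : i \notin S0 -> tnth theta0 i = 0.
Proof.
by apply: contraNeq => ti; apply: (fintype.subsetP theta0S0); rewrite inE.
Qed.

(** Shift the likelihood to [theta0], replace the slab by its value there, and dominate the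
    integrand by [C] times a Gaussian of standard deviation 2 centred at [theta0 + 3/2 z]. *)
Lemma slab_mass_ub (S : {set 'I_n}) (T : R) (x : Rn R n) : 0 <= T ->
  (\int[lebesgue_Rn R #|S|]_t
     (((fun theta => (normal_pdf_Rn theta x)%:E) \_
         [set theta | (T < norm_Rn (sub_Rn theta theta0))%R]) (zero_pad t)
      * (slab Pi #|S| t)%:E)
   <= (pivot x * expR (c1 * (#|S|%:R + 2 * #|S0|%:R)) * expR (- (T ^+ 2 / 8))
       * 6 ^+ #|S| * noise S x)%:E)%E.
Proof.
move=> T0.
set C := pivot x * _ * _ * _ * _.
have C0 : 0 <= C.
  apply: mulr_ge0; last by apply: prodr_ge0 => i _; exact: expR_ge0.
  do 3?[apply: mulr_ge0; rewrite ?expR_ge0 ?exprn_ge0//].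
  exact: ltW.
pose m (j : 'I_#|S|) := tnth theta0 (enum_val j) +
  3 / 2 * (tnth x (enum_val j) - tnth theta0 (enum_val j)) : R.
rewrite -(integral_scaled_normal_pdf_prod _ _ m 2)//.
apply: ge0_le_integral_nonmeasurable => t.
  rewrite mule_ge0 ?lee_fin ?density_ge0// patchE.
  by case: ifP => // _; rewrite lee_fin normal_pdf_Rn_ge0.
have rhs0 : 0 <= C * \prod_(j < #|S|) normal_pdf (m j) 2 (tnth t j).
  by rewrite mulr_ge0// prodr_ge0// => j _; exact: normal_pdf_ge0.
rewrite patchE; case: ifPn => [/set_mem/= Tt|_]; last by rewrite mul0e lee_fin.
rewrite -!EFinM lee_fin.
set theta := zero_pad t in Tt *.
pose h i := tnth theta i - tnth theta0 i.
pose z i := tnth x i - tnth theta0 i.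
have hT : T ^+ 2 <= \sum_i h i ^+ 2.
  have := ltW Tt; rewrite -ler_sqr ?nnegrE ?sqrtr_ge0// sqr_norm_Rn.
  by under eq_bigr do rewrite tnth_mktuple.
rewrite (normal_pdf_Rn_shift _ _ theta0).
have := slab_le S S0 t (coord_proj S0 theta0); rewrite zero_pad_coord_proj//.
rewrite -/theta -[\sum_i (tnth theta i - tnth theta0 i) ^+ 2]/(\sum_i h i ^+ 2).
move=> slabt.
have prodE : (\prod_i expR (h i * z i - 2^-1 * h i ^+ 2)) *
    expR (64^-1 * \sum_i h i ^+ 2) * expR (8^-1 * \sum_i h i ^+ 2) =
    \prod_i expR (h i * z i - 23 / 64 * h i ^+ 2).
  rewrite -!expR_sum -!expRD; congr expR.
  by rewrite !mulr_sumr -!big_split/=; apply: eq_bigr => i _; field.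
have prod_le : \prod_i expR (h i * z i - 23 / 64 * h i ^+ 2) <=
    noise S x * (6 ^+ #|S| * \prod_(j < #|S|) normal_pdf (m j) 2 (tnth t j)).
  have -> : 6 ^+ #|S| * \prod_(j < #|S|) normal_pdf (m j) 2 (tnth t j) =
      \prod_(i in S) (6 * normal_pdf (tnth theta0 i + 3 / 2 * z i) 2 (tnth theta i)).
    rewrite big_split/= prodr_const; congr (_ * _); rewrite [RHS]big_enum_val/=.
    by apply: eq_bigr => j _; rewrite zero_pad_enum_val.
  rewrite /noise [X in _ <= X * _]big_mkcond [X in _ <= _ * X]big_mkcond -big_split/=.
  (* Three kinds of coordinates: in [S] the Gaussian is kept for the integration; in [S0] only, it
     is bounded by 1 and the noise remains; elsewhere [h i = 0] and the factor is 1. *)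
  apply: ler_prod => i _; rewrite expR_ge0/= inE.
  have [iS|iS] := boolP (i \in S) => /=.
    apply: le_trans (numerator_factor _ _) _.
    rewrite ler_pM2l ?expR_gt0//; apply: le_trans (normal_pdf2_lb _ _).
    by rewrite ler_expR/h /z; lra.
  rewrite mulr1; case: ifPn => iS0.
    apply: le_trans (numerator_factor _ _) _.
    by rewrite ler_piMr ?expR_ge0// expR_le1; have := sqr_ge0 (h i - 3 / 2 * z i); lra.
  by rewrite /h (zero_padN _ iS) theta0_out// subrr mul0r expr0n mulr0 subrr expR0.
rewrite -[\prod_i expR _]/(\prod_i expR (h i * z i - 2^-1 * h i ^+ 2)).
(* In the far region the reserve [h^2 / 8] pays for [T^2 / 8]. *)
have expT : 1 <= expR (- (T ^+ 2 / 8)) * expR (8^-1 * \sum_i h i ^+ 2).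
  by rewrite -expRD -[leLHS]expR0 ler_expR; lra.
set P := \prod_i expR (h i * z i - 2^-1 * h i ^+ 2) in prodE *.
have P0 : 0 <= P by apply: prodr_ge0 => i _; exact: expR_ge0.
have phi0 : 0 <= normal_pdf_Rn theta0 x by exact: normal_pdf_Rn_ge0.
apply: (@le_trans _ _ (pivot x * expR (c1 * (#|S|%:R + 2 * #|S0|%:R)) *
   (P * expR (64^-1 * \sum_i h i ^+ 2)))).
  apply: le_trans (ler_wpM2l _ slabt) _; first by rewrite mulr_ge0.
  by rewrite /pivot le_eqVlt; apply/orP; left; apply/eqP; ring.
have L0 : 0 <= pivot x * expR (c1 * (#|S|%:R + 2 * #|S0|%:R)).
  by rewrite mulr_ge0 ?expR_ge0// ltW.
set Q := \prod_(j < #|S|) _ in prod_le rhs0 *.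
rewrite (_ : C * Q = pivot x * expR (c1 * (#|S|%:R + 2 * #|S0|%:R)) *
  (expR (- (T ^+ 2 / 8)) * (noise S x * (6 ^+ #|S| * Q)))); last by rewrite /C; ring.
apply: ler_wpM2l => //.
apply: (@le_trans _ _ (expR (- (T ^+ 2 / 8)) *
  \prod_i expR (h i * z i - 23 / 64 * h i ^+ 2))).
  rewrite -prodE mulrCA.
  by rewrite ler_peMr// mulr_ge0 ?expR_ge0.
by rewrite ler_pM2l ?expR_gt0.
Qed.

(** The integrand dominates [C] times a Gaussian of standard deviation [1/2] centred at
    [theta0 + 32/33 z], so no noise factor appears. *)
Lemma slab_mass_lb (x : Rn R n) :
  ((pivot x * expR (- (c1 * (3 * #|S0|%:R))))%:E <=
   \int[lebesgue_Rn R #|S0|]_t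
     ((normal_pdf_Rn (zero_pad t) x)%:E * (slab Pi #|S0| t)%:E))%E.
Proof.
set C := pivot x * _.
have C0 : 0 <= C by rewrite mulr_ge0 ?expR_ge0// ltW.
pose m (j : 'I_#|S0|) := tnth theta0 (enum_val j) +
  32 / 33 * (tnth x (enum_val j) - tnth theta0 (enum_val j)) : R.
rewrite -(integral_scaled_normal_pdf_prod _ _ m 2^-1)//.
apply: ge0_le_integral_nonmeasurable => t.
  by rewrite lee_fin mulr_ge0// prodr_ge0// => j _; exact: normal_pdf_ge0.
rewrite -!EFinM lee_fin.
set theta := zero_pad t.
pose h i := tnth theta i - tnth theta0 i.
pose z i := tnth x i - tnth theta0 i.
rewrite (normal_pdf_Rn_shift _ _ theta0).
(* Both supports are [S0], hence the cost [3 * #|S0|]. *)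
have := slab_le S0 S0 (coord_proj S0 theta0) t; rewrite zero_pad_coord_proj//.
rewrite -/theta.
under [X in expR (64^-1 * X)]eq_bigr do rewrite -opprB sqrrN.
rewrite -[\sum_i (tnth theta i - tnth theta0 i) ^+ 2]/(\sum_i h i ^+ 2).
move=> slabt.
have prod_ge : \prod_(j < #|S0|) normal_pdf (m j) 2^-1 (tnth t j) <=
    \prod_i expR (h i * z i - 33 / 64 * h i ^+ 2).
  have -> : \prod_(j < #|S0|) normal_pdf (m j) 2^-1 (tnth t j) =
      \prod_(i in S0) normal_pdf (tnth theta0 i + 32 / 33 * z i) 2^-1 (tnth theta i).
    by rewrite [RHS]big_enum_val/=; apply: eq_bigr => j _; rewrite zero_pad_enum_val.
  rewrite big_mkcond; apply: ler_prod => i _.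
  case: ifPn => iS0; rewrite ?normal_pdf_ge0 ?ler01/=.
    apply: le_trans (normal_pdf_half_ub _ _) _.
    apply: le_trans (denominator_factor _ _).
    by rewrite ler_expR /h /z; lra.
  by rewrite /h (zero_padN _ iS0) theta0_out// subrr mul0r expr0n mulr0 subrr expR0.
rewrite -[\prod_i expR _]/(\prod_i expR (h i * z i - 2^-1 * h i ^+ 2)).
have prodE : \prod_i expR (h i * z i - 33 / 64 * h i ^+ 2) =
    \prod_i expR (h i * z i - 2^-1 * h i ^+ 2) * expR (- (64^-1 * \sum_i h i ^+ 2)).
  rewrite -!expR_sum -!expRD; congr expR.
  by rewrite mulr_sumr -sumrN -big_split/=; apply: eq_bigr => i _; field.
apply: le_trans (ler_wpM2l C0 prod_ge) _.
rewrite prodE; set P := \prod_i _.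
have P0 : 0 <= P by apply: prodr_ge0 => i _; exact: expR_ge0.
have phi0 : 0 <= normal_pdf_Rn theta0 x by exact: normal_pdf_Rn_ge0.
rewrite /C /pivot expRN expRN.
rewrite (_ : #|S0|%:R + 2 * #|S0|%:R = 3 * #|S0|%:R :> R) in slabt; last by ring.
set E1 := expR (c1 * _) in slabt *; set E2 := expR (64^-1 * _) in slabt *.
rewrite [leLHS](_ : _ = normal_pdf_Rn theta0 x * P *
    (slab Pi #|S0| (coord_proj S0 theta0) / (E1 * E2))); last first.
  by field; rewrite ?gt_eqF ?expR_gt0.
rewrite ler_wpM2l ?mulr_ge0// ler_pdivrMr ?mulr_gt0 ?expR_gt0// mulrA.
exact: slabt.
Qed.

Lemma measurable_norm_gt (T : R) :
  measurable [set theta : Rn R n | T < norm_Rn (sub_Rn theta theta0)].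
Proof.
have mnorm : measurable_fun setT
    (fun theta : Rn R n => norm_Rn (sub_Rn theta theta0) : R).
  have msum : measurable_fun setT (fun theta : Rn R n =>
      \sum_(i < n) tnth (sub_Rn theta theta0) i ^+ 2 : R).
    apply: measurable_sum => i; under eq_fun do rewrite tnth_mktuple.
    apply: measurable_funX; apply: measurable_funB => //.
    exact: measurable_tnth.
  exact: (measurableT_comp (continuous_measurable_fun (@sqrt_continuous R)) msum).
rewrite [X in measurable X](_ : _ = setT `&` (fun theta : Rn R n =>
  norm_Rn (sub_Rn theta theta0)) @^-1` `]T, +oo[); first exact: mnorm.
by rewrite setTI; apply/seteqP; split => theta /=; rewrite in_itv/= andbT.
Qed.

(** The passage to square roots: either [v > 1 >= y], or [v^2 <= v]. *)
Let min_sqr (y v : R) : 0 <= v -> y <= 1 -> y <= v ^+ 2 -> y <= v.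
Proof. by move=> v0 y1 yv; have [v1|v1] := leP v 1; nra. Qed.

(** The denominator [D] is at least its [S0] term, and the mass of each model is at most [D];
    [min_sqr] is then applied model by model. *)
Lemma posterior_le (T : R) (x : Rn R n) : 0 <= T ->
  (posterior Pi x [set theta | (T < norm_Rn (sub_Rn theta theta0))%R] <=
   \sum_(S : {set 'I_n}) (amplitude Pi c1 S0 T S * \prod_(i in S :|: S0)
      expR (3 / 8 * (tnth x i - tnth theta0 i) ^+ 2))%:E)%E.
Proof.
move=> T0; set B := [set theta | _].
pose phi (theta : Rn R n) := (normal_pdf_Rn theta x)%:E.
pose mass f (S : {set 'I_n}) := ((support_weight Pi S)%:E *
  \int[lebesgue_Rn R #|S|]_t (f (zero_pad t) * (slab Pi #|S| t)%:E))%E.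
have w0 S := support_weight_gt0 Pi S.
have phi0 theta : (0 <= phi theta)%E by rewrite lee_fin normal_pdf_Rn_ge0.
have mphi : measurable_fun setT phi.
  apply/measurable_EFinP; under eq_fun do rewrite normal_pdf_Rn_sym.
  exact: measurable_normal_pdf_Rn.
have phiB0 theta : (0 <= (phi \_ B) theta)%E by rewrite patchE; case: ifP.
have mphiB : measurable_fun setT (phi \_ B).
  apply/(measurable_restrictT _ (measurable_norm_gt T)).
  exact: measurable_funTS.
have mass0 f S : (forall theta, 0 <= f theta)%E -> (0 <= mass f S)%E.
  move=> f0; rewrite mule_ge0 ?lee_fin ?(ltW (w0 _))//.
  by apply: integral_ge0 => t _; rewrite mule_ge0 ?lee_fin ?density_ge0.
have massB S : (mass (phi \_ B) S <= mass phi S)%E.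
  apply: lee_wpmul2l; first by rewrite lee_fin ltW.
  apply: ge0_le_integral_nonmeasurable => t.
    by rewrite mule_ge0 ?lee_fin ?density_ge0.
  rewrite lee_wpmul2r ?lee_fin ?density_ge0// patchE.
  by case: ifP.
rewrite /posterior integral_mkcond (ge0_integral_prior Pi (phi \_ B) mphiB phiB0).
set D := (X in (_ / X)%E).
have DE : D = (\sum_S mass phi S)%E by exact: (ge0_integral_prior Pi phi mphi phi0).
have D1 : (D <= 1)%E.
  apply: (@le_trans _ _ (\int[prior Pi]_theta (cst 1 theta)))%E.
    apply: ge0_le_integral_nonmeasurable => // theta.
    by rewrite lee_fin normal_pdf_Rn_le1.
  by rewrite integral_cst// mul1e; exact: probability_le1.
have mass_le S : (mass phi S <= D)%E.
  rewrite DE (bigD1 S)//= leeDl//; apply: sume_ge0 => S' _; exact: mass0.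
pose lb := support_weight Pi S0 * (pivot x * expR (- (c1 * (3 * #|S0|%:R)))).
have lb0 : 0 < lb by apply: mulr_gt0 => //; apply: mulr_gt0; rewrite ?expR_gt0 ?pivot_gt0.
have lbD : (lb%:E <= D)%E.
  apply: le_trans (mass_le S0); rewrite /lb EFinM.
  by apply: lee_wpmul2l; [rewrite lee_fin ltW|exact: slab_mass_lb].
(* Since [0 < lb <= D <= 1], the extended quotient is a real one. *)
have [d DEd] : exists d, D = d%:E.
  exists (fine D); rewrite fineK// ge0_fin_numE; last by apply: le_trans lbD; rewrite lee_fin ltW.
  exact: le_lt_trans D1 (ltry _).
have d0 : 0 < d by rewrite -lte_fin -DEd; apply: lt_le_trans lbD; rewrite lte_fin.
rewrite DEd inver gt_eqF// lee_pdivrMr// ge0_sume_distrl; last first.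
  move=> S _; rewrite lee_fin mulr_ge0//.
    exact: amplitude_ge0.
  by apply: prodr_ge0 => i _; exact: expR_ge0.
apply: lee_sum => S _; rewrite -/(mass _ _).
have [k kE] : exists k, mass (phi \_ B) S = k%:E.
  exists (fine (mass (phi \_ B) S)); rewrite fineK// ge0_fin_numE ?mass0//.
  exact: le_lt_trans (le_trans (massB S) (mass_le S)) (le_lt_trans D1 (ltry _)).
have kd : k <= d by rewrite -lee_fin -kE -DEd; exact: le_trans (mass_le S).
rewrite kE -EFinM lee_fin -ler_pdivrMr//.
set V := amplitude Pi c1 S0 T S * _.
have V0 : 0 <= V.
  apply: mulr_ge0; last by apply: prodr_ge0 => i _; exact: expR_ge0.
  exact: amplitude_ge0.
apply: min_sqr => //; first by rewrite ler_pdivrMr// mul1r.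
rewrite ler_pdivrMr//; apply: (@le_trans _ _ (V ^+ 2 * lb)); last first.
  by rewrite ler_wpM2l ?sqr_ge0// -lee_fin -DEd.
rewrite -lee_fin -kE.
apply: le_trans (lee_wpmul2l _ (slab_mass_ub S _ _ T0)) _.
  by rewrite lee_fin ltW.
rewrite -EFinM lee_fin.
have noiseE : noise S x = (\prod_(i in S :|: S0)
    expR (3 / 8 * (tnth x i - tnth theta0 i) ^+ 2)) ^+ 2.
  rewrite -prodrXl; apply: eq_bigr => i _; rewrite [RHS]expr2 -expRD.
  by congr expR; field.
(* The costs [2 * #|S0|] above and [3 * #|S0|] below add up to the 5 in [amplitude]. The base 9
   replaces 6 to have the square root 3. *)
have ampE : amplitude Pi c1 S0 T S ^+ 2 = support_weight Pi S / support_weight Pi S0 *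
    (expR (c1 * (#|S|%:R + 2 * #|S0|%:R)) / expR (- (c1 * (3 * #|S0|%:R))))
    * expR (- (T ^+ 2 / 8)) * 9 ^+ #|S|.
  rewrite /amplitude !exprMn sqr_sqrtr; last by rewrite divr_ge0// ltW.
  rewrite -expRN -expRD opprK -!expRM_natl -exprM mulnC exprM.
  by congr (_ * expR _ * expR _ * _ ^+ _); field.
rewrite /V exprMn -noiseE ampE /lb.
have n0 : 0 <= noise S x by apply: prodr_ge0 => i _; exact: expR_ge0.
rewrite [leRHS](_ : _ = support_weight Pi S * (pivot x *
  expR (c1 * (#|S|%:R + 2 * #|S0|%:R)) * expR (- (T ^+ 2 / 8)) * 9 ^+ #|S| *
  noise S x)); last first.
  by field; rewrite ?gt_eqF ?expR_gt0.
rewrite ler_pM2l// ler_wpM2r// ler_wpM2l ?lerXn2r ?nnegrE//; last by lra.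
by do 2?[apply: mulr_ge0; rewrite ?expR_ge0//]; exact: ltW.
Qed.

(** The noise on [S :|: S0] has mean [2 ^+ #|S :|: S0|], and the cardinality is subadditive. *)
Lemma expected_posterior_le (T : R) : 0 <= T ->
  (\int[normal_Rn theta0]_x
     posterior Pi x [set theta | (T < norm_Rn (sub_Rn theta theta0))%R] <=
   (\sum_(S : {set 'I_n}) amplitude Pi c1 S0 T S * 2 ^+ (#|S| + #|S0|))%:E)%E.
Proof.
move=> T0.
pose F (S : {set 'I_n}) (x : Rn R n) := (amplitude Pi c1 S0 T S *
  \prod_(i in S :|: S0) expR (3 / 8 * (tnth x i - tnth theta0 i) ^+ 2)).
have N0 (A : {set 'I_n}) (x : Rn R n) :
    0 <= \prod_(i in A) expR (3 / 8 * (tnth x i - tnth theta0 i) ^+ 2) :> R.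
  by apply: prodr_ge0 => i _; exact: expR_ge0.
have int0 A x : (0 <= \int[prior Pi]_(theta in A) (normal_pdf_Rn theta x)%:E)%E.
  by apply: integral_ge0 => theta _; rewrite lee_fin normal_pdf_Rn_ge0.
apply: (@le_trans _ _ (\int[normal_Rn theta0]_x (\sum_S (F S x)%:E))%E).
  apply: ge0_le_integral_nonmeasurable => x; last exact: posterior_le.
  by rewrite mule_ge0 ?inve_ge0.
rewrite ge0_integral_sum//; last 2 first.
- move=> S; apply/measurable_EFinP/measurable_funM => //.
  exact: measurable_noise.
- by move=> S x _; rewrite lee_fin mulr_ge0 ?amplitude_ge0.
rewrite -sumEFin; apply: lee_sum => S _.
under eq_integral do rewrite EFinM.
rewrite ge0_integralZl_EFin ?amplitude_ge0//; last 2 first.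
- by move=> x _; rewrite lee_fin.
- by apply/measurable_EFinP; exact: measurable_noise.
rewrite integral_noise -EFinM lee_fin ler_wpM2l ?amplitude_ge0//.
rewrite ler_eXn2l ?ltr1n//.
by rewrite cardsU leq_subr.
Qed.

End posterior_bound.

(** * Counting sets and numerical bounds *)

(* Keep one term of [(1 + p / n) ^+ n <= expR p]. *)
Lemma binomial_le (R : realType) (n p : nat) : (0 < p <= n)%N ->
  'C(n, p)%:R <= expR (p%:R + p%:R * ln (n%:R / p%:R)) :> R.
Proof.
move=> /andP[p0 pn]; have n0 : (0 < n)%N by exact: leq_trans pn.
pose y : R := p%:R / n%:R.
have y0 : 0 < y by rewrite divr_gt0 ?ltr0n.
have h : 'C(n, p)%:R * y ^+ p <= (1 + y) ^+ n.
  rewrite exprDn (bigD1 (Ordinal (pn : p < n.+1)%N))//= expr1n mul1r mulr_natl.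
  rewrite lerDl; apply: sumr_ge0 => i _.
  by rewrite mulrn_wge0// mulr_ge0 ?exprn_ge0// ltW.
have -> : expR (p%:R + p%:R * ln (n%:R / p%:R)) = expR p%:R / y ^+ p :> R.
  rewrite expRD; congr (_ * _).
  by rewrite expRM_natl lnK ?posrE ?divr_gt0 ?ltr0n// -exprVn /y invf_div.
rewrite ler_pdivlMr ?exprn_gt0//; apply: le_trans h _.
have -> : (p%:R : R) = n%:R * y by rewrite /y mulrC divfK// pnatr_eq0 -lt0n.
by rewrite expRM_natl lerXn2r ?nnegrE ?expR_ge0 ?expR_ge1Dx// addr_ge0// ltW.
Qed.

Lemma sum_by_card (R : realType) (n : nat) (f : nat -> R) :
  \sum_(S : {set 'I_n}) f #|S| = \sum_(p < n.+1) 'C(n, p)%:R * f p.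
Proof.
rewrite (partition_big (fun S : {set 'I_n} => inord #|S| : 'I_n.+1) xpredT)//=.
apply: eq_bigr => p _.
have pS (S : {set 'I_n}) : (inord #|S| == p :> 'I_n.+1) = (#|S| == p).
  by rewrite -val_eqE/= inordK// ltnS support_card_le.
rewrite (eq_bigl _ _ pS) (eq_bigr (fun=> f p)); last by move=> S /eqP ->.
rewrite sumr_const mulr_natl; congr (_ *+ _).
have := card_draws 'I_n p; rewrite card_ord => <-.
by apply: eq_card => S; rewrite !inE.
Qed.

(** Enlarges the support of [theta0] to exactly [p_n] elements, the size at which the rate condition
    bounds the prior from below. *)
Lemma superset_card (T : finType) (A : {set T}) (k : nat) :
  (#|A| <= k <= #|T|)%N -> exists2 B : {set T}, A \subset B & #|B| = k.
Proof.
elim: k => [|k IH] /andP[Ak kT].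
  by exists A => //; apply/eqP; rewrite -leqn0.
move: Ak; rewrite leq_eqVlt => /predU1P[<-|Ak]; first by exists A.
have [|B AB Bk] := IH; first by rewrite -ltnS Ak ltnW.
have [x xB] : exists x, x \in ~: B.
  by apply/set0Pn; rewrite -card_gt0 -(ltn_add2l #|B|) addn0 cardsC Bk.
exists (x |: B)%SET; first by rewrite subsetU// AB orbT.
by rewrite cardsU1 Bk; move: xB; rewrite inE => ->.
Qed.

Lemma geometric_half_le2 (R : realType) (n : nat) :
  \sum_(p < n) 2^-1 ^+ p <= 2 :> R.
Proof.
suff -> : \sum_(p < n) 2^-1 ^+ p = 2 - 2 * 2^-1 ^+ n :> R.
  by rewrite lerBlDr lerDl mulr_ge0// exprn_ge0.
elim: n => [|n IH]; first by rewrite big_ord0 expr0 mulr1 subrr.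
by rewrite big_ord_recr/= IH exprSr; field.
Qed.

(** From [e >= (5/4)^4 >= 12/5] and [(12/5)^3 >= 12]; it gives the ratio [6 / e^3 <= 1/2] of a
    geometric series. *)
Lemma expR3_ge12 (R : realType) : 12 <= expR 3 :> R.
Proof.
have e1 : 12 / 5 <= expR 1 :> R.
  have -> : 1 = 4%:R * 4^-1 :> R by field.
  rewrite expRM_natl; apply: (@le_trans _ _ ((5 / 4) ^+ 4)); first by lra.
  by rewrite lerXn2r ?nnegrE ?expR_ge0//; apply: le_trans (expR_ge1Dx _); lra.
have -> : 3 = 3%:R * 1 :> R by rewrite mulr1.
rewrite expRM_natl; apply: (@le_trans _ _ ((12 / 5) ^+ 3)); first by lra.
by rewrite lerXn2r ?nnegrE ?expR_ge0.
Qed.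

(** * Summing the amplitudes over the models *)

Section amplitude_sum.
Context {R : realType} {n : nat}.
Variables (Pi : sparse_prior R n) (c1 a b K : R).
Hypothesis c1_ge0 : 0 <= c1.
Hypothesis a_ge1 : 1 <= a.
Hypothesis b_ge : expR (7 + 2 * c1) <= b.
Hypothesis dim_pmf_le : forall p : nat, (p <= n)%N ->
  dim_pmf Pi p <= K * expR (- (a * p%:R * ln (b * n%:R / p%:R))).

Lemma prior_const_gt0 : 0 < K.
Proof.
have := lt_le_trans (dim_pmf_gt0 Pi (leq0n n)) (dim_pmf_le 0%N (leq0n n)).
by rewrite pmulr_lgt0 ?expR_gt0.
Qed.

(** [ln b >= 7 + 2 * c1] gives the linear term; [a >= 1] leaves a full [p log (n/p)] to offset the
    binomial coefficient. *)
Lemma dim_pmf_le_exp (p : nat) : (0 < p <= n)%N ->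
  dim_pmf Pi p <= K * expR (- ((7 + 2 * c1) * p%:R + p%:R * ln (n%:R / p%:R))).
Proof.
move=> /andP[p0 pn]; apply: le_trans (dim_pmf_le p pn) _.
have n0 := leq_trans p0 pn.
have K0 := prior_const_gt0.
rewrite ler_pM2l// ler_expR lerN2.
have b0 : 0 < b by exact: lt_le_trans (expR_gt0 _) b_ge.
have lb : 7 + 2 * c1 <= ln b by rewrite -ler_expR lnK.
have np0 : 0 <= ln (n%:R / p%:R : R).
  by rewrite ln_ge0// ler_pdivlMr ?ltr0n// mul1r ler_nat.
rewrite -[b * n%:R / p%:R]mulrA lnM ?posrE ?divr_gt0 ?ltr0n//.
set L := ln (n%:R / p%:R) in np0 *; set q : R := p%:R.
have q0 : 0 <= q by rewrite /q ler0n.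
apply: (@le_trans _ _ (1 * q * (ln b + L))); first by nra.
rewrite ler_wpM2r ?ler_wpM2r// addr_ge0//; apply: le_trans lb.
by rewrite addr_ge0// mulr_ge0.
Qed.

(** The terms [p log (n/p)] cancel, leaving [exp (- (6 + 2 c1) p)], written as a square for the
    coming square root. *)
Lemma binomial_dim_pmf_le (p : nat) : (p <= n)%N ->
  'C(n, p)%:R * dim_pmf Pi p <= K * expR (- ((3 + c1) * p%:R)) ^+ 2.
Proof.
move=> pn; have K0 := prior_const_gt0.
(* At [p = 0] the quotient by [p] is the default 0, and the factor [p] removes its logarithm. *)
have [->|p0] := posnP p.
  rewrite bin0 mul1r; apply: le_trans (dim_pmf_le 0%N (leq0n n)) _.
  by rewrite !mulr0 mul0r oppr0 expR0 expr1n.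
have p0n : (0 < p <= n)%N by rewrite p0.
apply: le_trans (ler_pM _ _ (binomial_le R _ _ p0n) (dim_pmf_le_exp _ p0n)) _ => //.
  by rewrite ltW// dim_pmf_gt0.
rewrite mulrCA ler_pM2l// -expRD [leRHS]expr2 -expRD ler_expR.
set q : R := p%:R; have q0 : 0 <= q by rewrite /q ler0n.
lra.
Qed.

(** The models of size [p] contribute [sqrt (C pi)], with [C] their number and [pi] the mass of [p].
    Its decay [exp (- (3 + c1) p)] beats [exp (c1 p / 2) 6^p], where 6 is the 3 of [amplitude] times
    the 2 of the noise. *)
Lemma sum_sqrt_support_weight_le :
  \sum_(S : {set 'I_n}) Num.sqrt (support_weight Pi S) *
    (expR (c1 / 2 * #|S|%:R) * 6 ^+ #|S|) <= 2 * Num.sqrt K.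
Proof.
have K0 := prior_const_gt0.
rewrite (sum_by_card _ _ (fun p => Num.sqrt (dim_pmf Pi p / 'C(n, p)%:R) *
  (expR (c1 / 2 * p%:R) * 6 ^+ p))).
apply: (@le_trans _ _ (\sum_(p < n.+1) Num.sqrt K * 2^-1 ^+ p)); last first.
  by rewrite -mulr_sumr mulrC ler_wpM2r ?sqrtr_ge0// geometric_half_le2.
apply: ler_sum => p _; have pn : (p <= n)%N by rewrite -ltnS.
have C0 : 0 < 'C(n, p)%:R :> R by rewrite ltr0n bin_gt0.
have -> : 'C(n, p)%:R * (Num.sqrt (dim_pmf Pi p / 'C(n, p)%:R) *
    (expR (c1 / 2 * p%:R) * 6 ^+ p)) =
    Num.sqrt ('C(n, p)%:R * dim_pmf Pi p) * (expR (c1 / 2 * p%:R) * 6 ^+ p).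
  rewrite mulrA; congr (_ * _).
  rewrite -[X in X * _](ger0_norm (ltW C0)) -sqrtr_sqr -sqrtrM ?sqr_ge0//.
  by congr Num.sqrt; field; rewrite gt_eqF.
apply: (@le_trans _ _ (Num.sqrt K * expR (- ((3 + c1) * p%:R)) *
    (expR (c1 / 2 * p%:R) * 6 ^+ p))).
  rewrite ler_wpM2r ?mulr_ge0 ?expR_ge0 ?exprn_ge0//.
  rewrite -[expR (- ((3 + c1) * p%:R))](ger0_norm (expR_ge0 _)) -sqrtr_sqr -sqrtrM ?(ltW K0)//.
  by rewrite ler_wsqrtr// binomial_dim_pmf_le.
rewrite -mulrA ler_wpM2l ?sqrtr_ge0// mulrA -expRD.
apply: (@le_trans _ _ (expR (p%:R * (- 3)) * 6 ^+ p)).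
  rewrite ler_wpM2r ?exprn_ge0// ler_expR.
  set q : R := p%:R; have q0 : 0 <= q by rewrite /q ler0n.
  have := mulr_ge0 c1_ge0 q0; lra.
rewrite expRM_natl -exprMn lerXn2r ?nnegrE ?mulr_ge0 ?expR_ge0//.
rewrite expRN mulrC ler_pdivrMr ?expR_gt0//.
by have := expR3_ge12 R; lra.
Qed.

(** The factors in [S] sum to [2 sqrt K]; those in [S0] are at most [K^2 exp (3 s^2)], which the
    decay in [T] absorbs. *)
Lemma sum_amplitude_le (S0 : {set 'I_n}) (s r : R) :
  (0 < #|S0|)%N -> 0 < s -> 1 <= r ->
  Num.max (#|S0|%:R * ln (n%:R / #|S0|%:R)) (ln (1 / dim_pmf Pi #|S0|)) <= s ^+ 2 ->
  \sum_(S : {set 'I_n}) amplitude Pi c1 S0 (45 * s + 10 * r) S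
      * 2 ^+ (#|S| + #|S0|)
    <= 2 * Num.sqrt K * K ^+ 2 * expR (- (r ^+ 2 / 10)).
Proof.
move=> q0 s0 r1; rewrite ge_max => /andP[Hq Hpi].
have K0 := prior_const_gt0.
have qn : (0 < #|S0| <= n)%N by rewrite q0 support_card_le.
have pi0 : 0 < dim_pmf Pi #|S0| by rewrite dim_pmf_gt0 ?support_card_le.
have w0 := support_weight_gt0 Pi S0.
set T := 45 * s + 10 * r; set q := #|S0| in q0 Hq Hpi qn pi0 *.
have pinv : (dim_pmf Pi q)^-1 <= expR (s ^+ 2).
  by rewrite -[leLHS]lnK ?posrE ?invr_gt0// ler_expR -div1r.
(* Both halves of the rate condition enter: one for the binomial coefficient, one for the mass of
   [q]. *)
have winv : (support_weight Pi S0)^-1 <= expR (q%:R / 2 + s ^+ 2) ^+ 2.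
  rewrite /support_weight -/q invf_div.
  apply: (@le_trans _ _ (expR (q%:R + s ^+ 2) * expR (s ^+ 2))).
    rewrite ler_pM ?invr_ge0 ?(ltW pi0)//.
    by apply: le_trans (binomial_le R _ _ qn) _; rewrite ler_expR lerD2l.
  by rewrite [leRHS]expr2 -!expRD ler_expR; lra.
(* The mass of [q] lies between [exp (- s^2)] and [K exp (- (7 + 2 c1) q)], so terms linear in [q]
   are controlled by [s^2] and [K]. *)
have Kq : expR ((7 + 2 * c1) * q%:R) <= K * expR (s ^+ 2).
  have := dim_pmf_le_exp q qn; rewrite opprD expRD mulrA => pile.
  have L0 : 0 <= q%:R * ln (n%:R / q%:R) :> R.
    rewrite mulr_ge0// ln_ge0// ler_pdivlMr ?ltr0n// mul1r ler_nat.
    by case/andP: qn.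
  have {}pile : dim_pmf Pi q <= K * expR (- ((7 + 2 * c1) * q%:R)).
    apply: le_trans pile _.
    by rewrite ler_piMr ?mulr_ge0 ?expR_ge0 ?(ltW K0)// expR_le1 oppr_le0.
  rewrite expRN ler_pdivlMr ?expR_gt0// in pile.
  apply: (@le_trans _ _ (K / dim_pmf Pi q)); last by rewrite ler_pM2l.
  by rewrite ler_pdivlMr// mulrC.
(* With [2^q <= e^q], the exponent in [q] is [(5 c1 + 3) q / 2], below [2 (7 + 2 c1) q]: two uses of
   [Kq]. *)
have q_cost : expR (c1 / 2 * (5 * q%:R)) * 2 ^+ q * expR (q%:R / 2 + s ^+ 2) <=
    K ^+ 2 * expR (3 * s ^+ 2).
  apply: (@le_trans _ _ (expR ((7 + 2 * c1) * q%:R) ^+ 2 * expR (s ^+ 2))).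
    apply: (@le_trans _ _ (expR (c1 / 2 * (5 * q%:R)) * expR q%:R *
        expR (q%:R / 2 + s ^+ 2))).
      rewrite ler_wpM2r ?expR_ge0// ler_wpM2l ?expR_ge0//.
      rewrite -[X in expR X]mulr1 expRM_natl lerXn2r ?nnegrE ?expR_ge0//.
      by apply: le_trans (expR_ge1Dx _); lra.
    rewrite -expRM_natl -!expRD ler_expR.
    set y : R := q%:R; have y0 : 0 <= y by rewrite /y ler0n.
    have := mulr_ge0 c1_ge0 y0; lra.
  have -> : K ^+ 2 * expR (3 * s ^+ 2) = (K * expR (s ^+ 2)) ^+ 2 * expR (s ^+ 2).
    by rewrite expRM_natl; ring.
  by rewrite ler_wpM2r ?expR_ge0// lerXn2r ?nnegrE ?expR_ge0// mulr_ge0 ?expR_ge0// ltW.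
(* The cross term of [T^2] is nonnegative, [45^2 / 16 >= 3] and [10^2 / 16 >= 1/10]. *)
have T_gain : expR (- (T ^+ 2 / 16)) * expR (3 * s ^+ 2) <= expR (- (r ^+ 2 / 10)).
  by rewrite -expRD ler_expR /T; nra.
pose E := expR (c1 / 2 * (5 * q%:R)) * 2 ^+ q * expR (- (T ^+ 2 / 16)).
have E0 : 0 <= E by rewrite !mulr_ge0 ?expR_ge0 ?exprn_ge0.
apply: (@le_trans _ _ (\sum_(S : {set 'I_n}) (Num.sqrt (support_weight Pi S) *
    (expR (c1 / 2 * #|S|%:R) * 6 ^+ #|S|)) * (expR (q%:R / 2 + s ^+ 2) * E))).
  apply: ler_sum => S _.
  have -> : amplitude Pi c1 S0 T S * 2 ^+ (#|S| + q) =
      Num.sqrt (support_weight Pi S) * (expR (c1 / 2 * #|S|%:R) * 6 ^+ #|S|) *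
      (Num.sqrt (support_weight Pi S0)^-1 * E).
    have -> : 6 = 3 * 2 :> R by ring.
    rewrite /amplitude -/q sqrtrM ?(ltW (support_weight_gt0 _ _))//.
    by rewrite mulrDr expRD exprD exprMn /E; ring.
  rewrite ler_wpM2l ?mulr_ge0 ?sqrtr_ge0 ?expR_ge0 ?exprn_ge0//.
  rewrite ler_wpM2r//.
  rewrite -[leRHS](ger0_norm (expR_ge0 _)) -sqrtr_sqr.
  by rewrite ler_wsqrtr.
rewrite -mulr_suml.
have E_le : expR (q%:R / 2 + s ^+ 2) * E <= K ^+ 2 * expR (- (r ^+ 2 / 10)).
  rewrite /E mulrA [_ * (_ * 2 ^+ q)]mulrC.
  apply: (@le_trans _ _ (K ^+ 2 * expR (3 * s ^+ 2) * expR (- (T ^+ 2 / 16)))).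
    by rewrite ler_wpM2r ?expR_ge0.
  by rewrite -mulrA ler_wpM2l ?sqr_ge0// mulrC.
rewrite -[leRHS]mulrA; apply: ler_pM => //.
- apply: sumr_ge0 => S _.
  by rewrite !mulr_ge0 ?sqrtr_ge0 ?expR_ge0 ?exprn_ge0.
- by rewrite mulr_ge0 ?expR_ge0.
- exact: sum_sqrt_support_weight_le.
Qed.

End amplitude_sum.

(** * Uniformity in the dimension and in the true parameter *)

Theorem theorem2p5 (R : realType) (Pi : forall n : nat, sparse_prior R n)
    (c1 a b K : R)
    (slab_gt0 : forall n : nat, (0 < n)%N -> forall p : nat, (p <= n)%N ->
      forall theta : Rn R p, 0 < slab (Pi n) p theta)
    (second_moment : forall n : nat, (0 < n)%N -> forall p : nat, (p <= n)%N ->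
      (\int[lebesgue_Rn R p]_theta
         (norm_Rn theta ^+ 2 * slab (Pi n) p theta)%:E < +oo)%E)
    (log_slab_var : forall n : nat, (0 < n)%N -> forall S : {set 'I_n},
      forall theta theta' : Rn R #|S|,
      ln (slab (Pi n) #|S| theta) - ln (slab (Pi n) #|S| theta')
        <= c1 * #|S|%:R + 64^-1 * norm_Rn (sub_Rn theta theta') ^+ 2)
    (log_slab_proj : forall n : nat, (0 < n)%N -> forall S' S : {set 'I_n},
      S' \subset S -> forall theta : Rn R #|S|,
      `| ln (slab (Pi n) #|S| theta)
         - ln (slab (Pi n) #|S'| (coord_proj S' (zero_pad theta))) |
        <= c1 * #|S|%:R + 64^-1 * norm_Rn (coord_proj (S :\: S')%SET (zero_pad theta)) ^+ 2)
    (a_ge1 : 1 <= a) (b_ge : expR (7 + 2 * c1) <= b)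
    (dim_pmf_le : forall n : nat, (0 < n)%N -> forall p : nat, (p <= n)%N ->
      dim_pmf (Pi n) p <= K * expR (- (a * p%:R * ln (b * n%:R / p%:R)))) :
  exists K' : R, forall (n p_n : nat) (r_n r : R),
    (1 <= p_n <= n)%N -> 0 < r_n ->
    Num.max (p_n%:R * ln (n%:R / p_n%:R)) (ln (1 / dim_pmf (Pi n) p_n))
      <= r_n ^+ 2 ->
    1 <= r ->
    (ereal_sup
       [set \int[normal_Rn theta0]_X
              posterior (Pi n) X
                [set theta | (45 * r_n + 10 * r < norm_Rn (sub_Rn theta theta0))%R]
       | theta0 in ell0 p_n]
     <= (K' * expR (- (r ^+ 2 / 10)))%:E)%E.
Proof.
(* [2 sqrt K] comes from the sum over models, [K^2] from absorbing the factors exponential in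
   [#|S0|]. *)
exists (2 * Num.sqrt K * K ^+ 2) => n p s r /andP[p0 pn] s0 rate r1.
have n0 : (0 < n)%N by exact: leq_trans pn.
have c0 := slab_const_ge0 _ _ (log_slab_var n n0) n0.
apply: ge_ereal_sup => _ [theta0 /= theta0p <-].
have [|S0 theta0S0 S0p] := superset_card _ (support_Rn theta0) p.
  by rewrite card_ord theta0p.
have T0 : 0 <= 45 * s + 10 * r by lra.
have post := expected_posterior_le _ _ (slab_gt0 n n0)
  (slab_ratio _ _ (slab_gt0 n n0) (log_slab_var n n0) (log_slab_proj n n0) c0)
  _ _ theta0S0 _ T0.
apply: le_trans post _.
rewrite lee_fin; apply: (sum_amplitude_le _ _ _ _ _ c0 a_ge1 b_ge (dim_pmf_le n n0)).
all: by rewrite ?S0p.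
Qed.
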